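(* Let $(M,A,g,F)$ be an almost para-Hermitian manifold with K\''ahler 2-form $F$ and let $G=g+F$. Then $M$ admits a linear connection with totally skew-symmetric torsion satisfying the Einstein metricity condition for $G$ (an NGT connection with totally skew-symmetric torsion) if and only if $M$ admits a linear connection with totally skew-symmetric torsion preserving the almost para-Hermitian structure, i.e. a linear connection $\nabla'$ with $\nabla' g=\nabla' A=0$ and totally skew-symmetric torsion.
   Context: An almost para-Hermitian manifold $(M,g,A)$ is a pseudo-Riemannian manifold with an endomorphism field $A$ satisfying $A^2=I$ and $g(AX,AY)=-g(X,Y)$; then $\dim M=2n$, the $\pm1$-eigensubbundles of $A$ both have dimension $n$ and $g$ has neutral signature $(n,n)$. Its K\''ahler 2-form is $F(X,Y)=g(AX,Y)$. The torsion of a linear connection $\nabla$ is $T(X,Y)=\nabla_XY-\nabla_YX-[X,Y]$, with $T(X,Y,Z)=g(T(X,Y),Z)$; it is totally skew-symmetric if $T(X,Y,Z)=-T(X,Z,Y)$. For $G=g+F$, a linear connection $\nabla$ satisfies the Einstein metricity condition if $XG(Y,Z)-G(\nabla_YX,Z)-G(Y,\nabla_XZ)=0$ for commuting vector fields $X,Y,Z$, equivalently $(\nabla_XG)(Y,Z)=-G(T(X,Y),Z)$. *)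

(* Defs.v *)
From HB Require Import structures.
From mathcomp Require Import all_boot all_order all_algebra.
From mathcomp Require Import all_classical all_reals all_analysis.
From mathcomp Require Import ring.

Set Implicit Arguments.
Unset Strict Implicit.
Unset Printing Implicit Defensive.

Import Order.TTheory GRing.Theory Num.Theory.
Import numFieldNormedType.Exports.

Local Open Scope classical_set_scope.
Local Open Scope ring_scope.

Section SmoothOn.
Context {R : realType} {m : nat}.
Implicit Types (U : set 'rV[R]_m) (f g : 'rV[R]_m -> R).

Fixpoint Ck_on (k : nat) U f : Prop :=
  (forall x, U x -> {for x, continuous f}) /\
  (if k is l.+1 then
     forall i : 'I_m,
       (forall x, U x -> derivable f x (delta_mx 0 i)) /\
       Ck_on l U (fun x => 'D_(delta_mx 0 i) f x)
   else True).

Definition smooth_on U f : Prop := forall k, Ck_on k U f.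

Lemma Ck_on_continuous k U f x : Ck_on k U f -> U x -> {for x, continuous f}.
Proof. by case: k => [|k] [cf _]; exact: cf. Qed.

Lemma Ck_onS k U f : Ck_on k.+1 U f -> Ck_on k U f.
Proof.
elim: k f => [|k IHk] f [cf df]; split=> // i.
by have [dfi Dfi] := df i; split=> //; apply: IHk.
Qed.

Lemma Ck_on_eq k U f g : open U -> (forall x, U x -> f x = g x) ->
  Ck_on k U f -> Ck_on k U g.
Proof.
move=> Uo; elim: k f g => [|k IHk] f g fg.
all: have nfg x : U x -> \forall y \near x, f y = g y
  by move=> Ux; near=> y; apply: fg; near: y; exact: open_nbhs_nbhs.
all: have cont : (forall x, U x -> {for x, continuous f}) ->
    forall x, U x -> {for x, continuous g}.
1,3: move=> cf x Ux; rewrite /prop_for /continuous_at -(fg x Ux);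
  exact: cvg_trans (near_eq_cvg (nfg x Ux)) (cf x Ux).
- by move=> [cf _]; split=> //; exact: cont.
- move=> [cf df]; split; first exact: cont.
  move=> i; have [dfi Dfi] := df i.
  split=> [x Ux|].
    by apply: (near_eq_derivable (nfg x Ux)); exact: dfi.
  by apply: IHk Dfi => x Ux; exact: near_eq_derive (nfg x Ux).
Unshelve. all: by end_near.
Qed.

Lemma Ck_on_cst k U (a : R) : open U -> Ck_on k U (fun=> a).
Proof.
move=> Uo; elim: k a => [|k IHk] a.
  by split=> // x _; exact: cst_continuous.
split=> [x _|i]; first exact: cst_continuous.
split=> [x _|]; first exact: derivable_cst.
by apply: (Ck_on_eq Uo _ (IHk 0)) => x _; rewrite derive_cst.
Qed.

Lemma Ck_onD k U f g : open U ->
  Ck_on k U f -> Ck_on k U g -> Ck_on k U (fun x => f x + g x).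
Proof.
move=> Uo; elim: k f g => [|k IHk] f g [cf df] [cg dg].
  by split=> // x Ux; apply: continuousD; [exact: cf|exact: cg].
split=> [x Ux|i]; first by apply: continuousD; [exact: cf|exact: cg].
have [dfi Dfi] := df i; have [dgi Dgi] := dg i.
split=> [x Ux|]; first by apply: derivableD; [exact: dfi|exact: dgi].
apply: (Ck_on_eq Uo _ (IHk _ _ Dfi Dgi)) => x Ux.
by rewrite -deriveD//; [exact: dfi|exact: dgi].
Qed.

Lemma Ck_onM k U f g : open U ->
  Ck_on k U f -> Ck_on k U g -> Ck_on k U (fun x => f x * g x).
Proof.
move=> Uo; elim: k f g => [|k IHk] f g Cf Cg.
  split=> // x Ux.
  by apply: continuousM; [exact: Ck_on_continuous Cf Ux
                         |exact: Ck_on_continuous Cg Ux].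
have [cf df] := Cf; have [cg dg] := Cg.
split=> [x Ux|i]; first by apply: continuousM; [exact: cf|exact: cg].
have [dfi Dfi] := df i; have [dgi Dgi] := dg i.
split=> [x Ux|]; first by apply: derivableM; [exact: dfi|exact: dgi].
have := Ck_onD Uo (IHk _ _ (Ck_onS Cf) Dgi) (IHk _ _ (Ck_onS Cg) Dfi).
apply: (Ck_on_eq Uo) => x Ux.
by rewrite (deriveM (dfi x Ux) (dgi x Ux)).
Qed.

End SmoothOn.

Section Charts.
Context {R : realType} {m : nat} {M : topologicalType}.

(* A homeomorphism from an open subset of M onto an open subset of R^m.  Both
   maps are total; their values outside [chart_dom] and [chart_cod] are
   irrelevant. *)
Record chart := Chart {
  chart_dom : set M;
  chart_map : M -> 'rV[R]_m;
  chart_inv : 'rV[R]_m -> M;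
  chart_dom_open : open chart_dom;
  chart_cod_open : open (chart_map @` chart_dom);
  chart_mapK : forall p, chart_dom p -> chart_inv (chart_map p) = p;
  chart_map_continuous : {within chart_dom, continuous chart_map};
  chart_inv_continuous :
    {within chart_map @` chart_dom, continuous chart_inv}
}.

Definition chart_cod (c : chart) : set 'rV[R]_m := chart_map c @` chart_dom c.

Definition chart_compatible (c d : chart) : Prop := forall i : 'I_m,
  smooth_on (chart_map c @` (chart_dom c `&` chart_dom d))
            (fun x => chart_map d (chart_inv c x) 0 i).

End Charts.
Arguments chart R m M : clear implicits.

Record manifold (R : realType) (m : nat) := Manifold {
  manifold_sort :> topologicalType;
  manifold_hausdorff : hausdorff_space manifold_sort;
  manifold_second_countable : @second_countable manifold_sort;
  atlas : set (chart R m manifold_sort);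
  atlas_cover : forall p : manifold_sort, exists2 c, atlas c & chart_dom c p;
  atlas_compatible : forall c d, atlas c -> atlas d -> chart_compatible c d
}.

Section SmoothFunctions.
Context {R : realType} {m : nat} (M : manifold R m).

Definition smooth (f : M -> R) : Prop :=
  forall c, atlas c -> smooth_on (chart_cod c) (fun x => f (chart_inv c x)).

Definition smooth_pred : {pred M -> R} := fun f => `[< smooth f >].

Lemma smooth_cst (a : R) : smooth (fun=> a).
Proof. by move=> c _ k; apply: Ck_on_cst; exact: chart_cod_open. Qed.

Lemma smoothD f g : smooth f -> smooth g -> smooth (f + g).
Proof.
move=> sf sg c ac k.
by apply: Ck_onD; [exact: chart_cod_open|exact: sf|exact: sg].
Qed.

Lemma smoothM f g : smooth f -> smooth g -> smooth (f * g).
Proof.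
move=> sf sg c ac k.
by apply: Ck_onM; [exact: chart_cod_open|exact: sf|exact: sg].
Qed.

Lemma smooth_subring : subring_closed smooth_pred.
Proof.
split=> [|f g /asboolP sf /asboolP sg|f g /asboolP sf /asboolP sg].
- by apply/asboolP; exact: smooth_cst.
- apply/asboolP; apply: smoothD => //.
  have -> : - g = (fun=> -1) * g by apply/funext => x; rewrite /GRing.mul /= mulN1r.
  by apply: smoothM => //; exact: smooth_cst.
- by apply/asboolP; exact: smoothM.
Qed.

HB.instance Definition _ :=
  GRing.isSubringClosed.Build (M -> R) smooth_pred smooth_subring.

Lemma smooth_scaler : GRing.scaler_closed smooth_pred.
Proof.
move=> a f /asboolP sf; apply/asboolP.
have -> : a *: f = (fun=> a) * f by [].
by apply: smoothM => //; exact: smooth_cst.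
Qed.

HB.instance Definition _ :=
  GRing.isScaleClosed.Build R (M -> R) smooth_pred smooth_scaler.

(* The algebra C^oo(M). *)
Record Cinf := MkCinf { Cinf_val :> M -> R; Cinf_valP : Cinf_val \in smooth_pred }.

HB.instance Definition _ := [isSub for Cinf_val].
HB.instance Definition _ := [Choice of Cinf by <:].
HB.instance Definition _ := GRing.SubChoice_isSubComPzRing.Build
  (M -> R) smooth_pred Cinf (subringClosedP _).
HB.instance Definition _ := [SubZmodule_isSubLmodule of Cinf by <:].

Lemma CinfDE (f g : Cinf) p : (f + g) p = f p + g p.
Proof. by []. Qed.

Lemma CinfME (f g : Cinf) p : (f * g) p = f p * g p.
Proof. by []. Qed.

Lemma CinfZE (a : R) (f : Cinf) p : (a *: f) p = a * f p.
Proof. by []. Qed.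

Lemma CinfP (f g : Cinf) : (forall p, f p = g p) -> f = g.
Proof. by move=> fg; apply/val_inj/funext. Qed.

Lemma CinfZAl (a : R) (f g : Cinf) : a *: (f * g) = (a *: f) * g.
Proof. by apply: CinfP => p; rewrite !(CinfZE, CinfME) mulrA. Qed.

Lemma CinfZAr (a : R) (f g : Cinf) : a *: (f * g) = f * (a *: g).
Proof. by rewrite mulrC CinfZAl mulrC. Qed.

End SmoothFunctions.

Section VectorFields.
Context {R : realType} {m : nat} (M : manifold R m).

Definition derivation (X : Cinf M -> Cinf M) : Prop :=
  linear X /\ (forall f g, X (f * g) = X f * g + f * X g).

Definition derivation_pred : {pred Cinf M -> (Cinf M)^o} :=
  fun X => `[< derivation X >].

Lemma derivation_submod : submod_closed derivation_pred.
Proof.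
split=> [|h X Y /asboolP[lX dX] /asboolP[lY dY]].
  apply/asboolP; split=> [a f g|f g]; rewrite (_ : forall u, (0 : Cinf M -> (Cinf M)^o) u = 0)//.
  by rewrite scaler0 addr0.
  by rewrite mul0r mulr0 addr0.
have E u : (h *: (X : Cinf M -> (Cinf M)^o) + Y) u = h * X u + Y u :> Cinf M by [].
apply/asboolP; split=> [a f g|f g]; rewrite !E.
  by rewrite lX lY mulrDr -CinfZAr scalerDr addrACA.
rewrite dX dY; ring.
Qed.

HB.instance Definition _ :=
  GRing.isSubmodClosed.Build (Cinf M) (Cinf M -> (Cinf M)^o)
    derivation_pred derivation_submod.

(* Vector fields on M, as the derivations of C^oo(M); they form a module over
   C^oo(M). *)
Record vfield := MkVfield {
  vfield_val : Cinf M -> (Cinf M)^o;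
  vfield_valP : vfield_val \in derivation_pred
}.

HB.instance Definition _ := [isSub for vfield_val].
HB.instance Definition _ := [Choice of vfield by <:].
HB.instance Definition _ := [SubChoice_isSubLmodule of vfield by <:].

Definition vfield_app (X : vfield) (f : Cinf M) : Cinf M := vfield_val X f.
Coercion vfield_app : vfield >-> Funclass.

Lemma vfieldP (X Y : vfield) : (forall f, X f = Y f) -> X = Y.
Proof. by move=> XY; apply/val_inj/funext. Qed.

Lemma vfieldDE (X Y : vfield) f : (X + Y) f = X f + Y f.
Proof. by []. Qed.

Lemma vfieldNE (X : vfield) f : (- X) f = - X f.
Proof. by []. Qed.

Lemma vfieldZE (h : Cinf M) (X : vfield) f : (h *: X) f = h * X f.
Proof. by []. Qed.

Lemma vfield_derivation (X : vfield) : derivation X.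
Proof. exact/asboolP/(vfield_valP X). Qed.

Lemma vfieldM (X : vfield) f g : X (f * g) = X f * g + f * X g.
Proof. by have [_] := vfield_derivation X; apply. Qed.

Lemma vfield_linear (X : vfield) : linear X.
Proof. by have [] := vfield_derivation X. Qed.

Lemma vfieldD (X : vfield) f g : X (f + g) = X f + X g.
Proof. by have := vfield_linear X 1 f g; rewrite !scale1r. Qed.

Lemma vfieldB (X : vfield) f g : X (f - g) = X f - X g.
Proof.
by have := vfield_linear X (- 1) g f; rewrite !scaleN1r ![- _ + _]addrC.
Qed.

Lemma bracket_subproof (X Y : vfield) :
  (fun f => X (Y f) - Y (X f)) \in derivation_pred.
Proof.
apply/asboolP; split=> [a f g|f g]; last by rewrite !vfieldM !vfieldD !vfieldM; ring.
by rewrite !vfield_linear scalerBr opprD addrACA.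
Qed.

Definition bracket (X Y : vfield) : vfield :=
  MkVfield (bracket_subproof X Y).

End VectorFields.

Section Geometry.
Context {R : realType} {m : nat}.

(* Tensor fields are C^oo(M)-multilinear maps on vector fields.  The tangent
   space at p is the space of values X_p : f |-> X f p of vector fields, and
   [metric_nondegenerate] is nondegeneracy at every point p of the bilinear form
   g_p(X_p, Y_p) = g(X, Y)(p). *)
Record almost_para_hermitian (M : manifold R m) := AlmostParaHermitian {
  metric : vfield M -> vfield M -> Cinf M;
  para : vfield M -> vfield M;
  metric_sym : forall X Y, metric X Y = metric Y X;
  metric_linear : forall X, scalar (metric X);
  metric_nondegenerate : forall (p : M) (X : vfield M),
    (forall Y, metric X Y p = 0) -> forall f : Cinf M, X f p = 0;
  para_linear : linear para;
  para_involutive : forall X, para (para X) = X;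
  metric_para : forall X Y, metric (para X) (para Y) = - metric X Y
}.

Record connection (M : manifold R m) := Connection {
  nabla :> vfield M -> vfield M -> vfield M;
  nabla_linearl : forall Y, linear (nabla^~ Y);
  nabla_addr : forall X, {morph nabla X : Y Z / Y + Z};
  nabla_leibniz : forall X (f : Cinf M) Y,
    nabla X (f *: Y) = X f *: Y + f *: nabla X Y
}.

Context {M : manifold R m}.
Implicit Types (D : connection M) (S : almost_para_hermitian M).
Implicit Types (X Y Z : vfield M).

Definition torsion D X Y : vfield M := D X Y - D Y X - bracket X Y.

Definition nabla_form D (B : vfield M -> vfield M -> Cinf M) X Y Z : Cinf M :=
  X (B Y Z) - B (D X Y) Z - B Y (D X Z).

Definition nabla_endo D (A : vfield M -> vfield M) X Y : vfield M :=
  D X (A Y) - A (D X Y).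

Definition kahler_form S X Y : Cinf M := metric S (para S X) Y.

Definition gen_metric S X Y : Cinf M := metric S X Y + kahler_form S X Y.

Definition skew_torsion S D : Prop := forall X Y Z,
  metric S (torsion D X Y) Z = - metric S (torsion D X Z) Y.

Definition einstein_metricity D (G : vfield M -> vfield M -> Cinf M) : Prop :=
  forall X Y Z, nabla_form D G X Y Z = - G (torsion D X Y) Z.

Lemma metricBl S X Y Z : metric S (X - Y) Z = metric S X Z - metric S Y Z.
Proof.
have := metric_linear S Z (- 1) Y X.
by rewrite scaleN1r mulN1r ![metric S _ Z]metric_sym ![- _ + _]addrC.
Qed.

Lemma paraB S X Y : para S (X - Y) = para S X - para S Y.
Proof.
by have := para_linear S (- 1) Y X; rewrite !scaleN1r ![- _ + _]addrC.
Qed.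

Lemma gen_metricBl S X Y Z :
  gen_metric S (X - Y) Z = gen_metric S X Z - gen_metric S Y Z.
Proof. by rewrite /gen_metric /kahler_form paraB !metricBl; ring. Qed.

(* On commuting vector fields the condition is
   X G(Y, Z) - G(nabla_Y X, Z) - G(Y, nabla_X Z) = 0. *)
Lemma einstein_metricityE S D :
  einstein_metricity D (gen_metric S) <->
  forall X Y Z,
    X (gen_metric S Y Z) - gen_metric S (D Y X) Z - gen_metric S Y (D X Z) =
    gen_metric S (bracket X Y) Z.
Proof.
split=> EM X Y Z; have := EM X Y Z; rewrite /nabla_form /torsion !gen_metricBl.
  by move/eqP; rewrite !subr_eq => /eqP ->; ring.
by move=> <-; ring.
Qed.

End Geometry.

(* Main.v *)
Require Import Defs.
From mathcomp Require Import all_boot all_order all_algebra.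
From mathcomp Require Import all_classical all_reals all_analysis.
From mathcomp Require Import ring lra.

Set Implicit Arguments.
Unset Strict Implicit.
Unset Printing Implicit Defensive.

Import GRing.Theory.

Local Open Scope ring_scope.

(** Both implications come from an explicit change of connection
    [N X Y = D X Y + K X Y], where [K] is a tensor built from the torsion [T]
    of the given connection [D] and the structure [A].  Nothing has to be
    solved on the manifold: since [g (A U) V = - g U (A V)], every expression
    [T (A^i X) (A^j Y) (A^k Z)] (with [T X Y Z = g (T X Y) Z]) is the metric
    product of [Z] with an explicit vector field.

    To find [K], split the tangent spaces into the eigenspaces of [A].  On
    eigenvectors [X], [Y], [Z] with eigenvalues [a], [b], [c] (all equal to 1
    or -1), every such tensor is a multiple of [T X Y Z], with a coefficient
    depending on [a], [b], [c] only.  The symmetric and skew parts in [Y], [Z]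
    of the Einstein condition express [nabla g] and [nabla F] by the torsion
    ([einstein_nabla_metric], [einstein_nabla_kahler]), and so give linear
    equations for the coefficients, one set for each choice of signs.

    From an adapted connection with skew torsion [T], the NGT connection has
    torsion with coefficient [(a + b + c) / 3] ([ngt_torsionE]), which is again
    a 3-form because this function of the signs is symmetric.  It takes the
    values 1, 1/3, -1/3, -1 and never vanishes, so the step can be undone: its
    inverse is the symmetric function [a + b + c - 2 a b c] ([para_torsionE]),
    with values 1, 3, -3, -1.  Interpolating the coefficients of [K] by
    polynomials in [a], [b], [c] yields [ngt_difference] in the first direction
    and [para_difference] in the second.

    The Einstein and parallelism conditions are then identities between values
    of a skew trilinear form at a point, that is, linear arithmetic in the real
    numbers ([ngt_einstein], [para_nabla_metric], [para_nabla_kahler]).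
    Nondegeneracy of the metric serves only to pass from [nabla F = 0] and
    [nabla g = 0] to [nabla A = 0] ([para_nabla_endo]). *)

(** * Torsion and change of connection *)

Section Torsion.
Context {R : realType} {m : nat} {M : manifold R m}.
Implicit Types (D : connection M) (X Y Z : vfield M) (f h : Cinf M).
Implicit Types (T K : vfield M -> vfield M -> vfield M).

Lemma CinfNE f p : (- f) p = - f p. Proof. by []. Qed.

Lemma Cinf0E p : (0 : Cinf M) p = 0. Proof. by []. Qed.

Definition Cinf_cst (a : R) : Cinf M := a *: (1 : Cinf M).

Lemma Cinf_cstE a p : Cinf_cst a p = a.
Proof. by rewrite /Cinf_cst CinfZE mulr1. Qed.

(** The condition under which the field can be added to a connection. *)
Definition bilinear_field K : Prop :=
  (forall Y, linear (K^~ Y)) /\ (forall X, linear (K X)).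

Lemma bracketC X Y : bracket X Y = - bracket Y X.
Proof. by apply: vfieldP => h; rewrite vfieldNE /bracket /vfield_app /= opprB. Qed.

Lemma bracketPl f X Y Z :
  bracket (f *: X + Y) Z = f *: bracket X Z + bracket Y Z - Z f *: X.
Proof.
apply: vfieldP => h; rewrite 2!vfieldDE vfieldNE !vfieldZE.
have E U V : bracket U V h = U (V h) - V (U h) by [].
rewrite !E !vfieldDE !vfieldZE vfieldD vfieldM; ring.
Qed.

Lemma torsionC D X Y : torsion D X Y = - torsion D Y X.
Proof.
by rewrite /torsion [bracket X Y]bracketC !opprD !opprK [- D Y X + _]addrC.
Qed.

Lemma nablaDZ D X f Y Z :
  D X (f *: Y + Z) = X f *: Y + f *: D X Y + D X Z.
Proof. by rewrite nabla_addr nabla_leibniz. Qed.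

(** The derivatives of the coefficient [f] from the Leibniz rule and from the
    bracket cancel: torsion is a tensor. *)
Lemma torsion_linearl D Y : linear ((torsion D)^~ Y).
Proof.
move=> f X Z; apply: vfieldP => h.
rewrite /torsion bracketPl (nabla_linearl D Y) nablaDZ.
rewrite !(vfieldDE, vfieldNE, vfieldZE); ring.
Qed.

Lemma torsion_bilinear D : bilinear_field (torsion D).
Proof.
split; first exact: torsion_linearl.
move=> X f Y Z; rewrite [LHS]torsionC (torsion_linearl D X) opprD -scalerN.
by rewrite -!torsionC.
Qed.

(** The torsion of [D + K] when [T] is the torsion of [D].  Keeping [T] a free
    argument lets the algebra below speak of an arbitrary skew field. *)
Definition shift_torsion T K X Y : vfield M := T X Y + K X Y - K Y X.

Section Shift.
Variables (D : connection M) (K : vfield M -> vfield M -> vfield M).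
Hypothesis bK : bilinear_field K.

Let shift X Y : vfield M := D X Y + K X Y.

Let shift_linearl Y : linear (shift^~ Y).
Proof.
move=> f X Z; rewrite /shift (nabla_linearl D Y) (bK.1 Y) scalerDr.
by rewrite addrACA.
Qed.

Let shift_addr X : {morph shift X : Y Z / Y + Z}.
Proof.
move=> Y Z; rewrite /shift nabla_addr.
by have := bK.2 X 1 Y Z; rewrite !scale1r => ->; rewrite addrACA.
Qed.

Let shift_leibniz X f Y : shift X (f *: Y) = X f *: Y + f *: shift X Y.
Proof.
have K0 : K X 0 = 0 by have := bK.2 X (-1) 0 0; rewrite scaler0 addr0 scaleN1r addNr.
have := bK.2 X f Y 0; rewrite !addr0 K0 addr0 => KZ.
by rewrite /shift KZ nabla_leibniz scalerDr addrA.
Qed.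

Definition shift_connection : connection M :=
  Connection shift_linearl shift_addr shift_leibniz.

Lemma shift_connectionE X Y : shift_connection X Y = D X Y + K X Y.
Proof. by []. Qed.

Lemma torsion_shift X Y :
  torsion shift_connection X Y = shift_torsion (torsion D) K X Y.
Proof.
apply: vfieldP => h; rewrite /shift_torsion /torsion !shift_connectionE.
rewrite !(vfieldDE, vfieldNE); ring.
Qed.

End Shift.
End Torsion.

(** * Covariant derivatives of g, A and F *)

Section ParaHermitian.
Context {R : realType} {m : nat} {M : manifold R m}.
Variable S : almost_para_hermitian M.
Implicit Types (D : connection M) (X Y Z U V W : vfield M).
Implicit Types (T : vfield M -> vfield M -> vfield M).

Local Notation g := (metric S).
Local Notation A := (para S).
Local Notation cst := (@Cinf_cst R m M).

Lemma metricDl U V W : g (U + V) W = g U W + g V W.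
Proof.
by have := metric_linear S W 1 U V; rewrite scale1r mul1r !(Defs.metric_sym S W).
Qed.

Lemma metricNl U W : g (- U) W = - g U W.
Proof. by rewrite -[- U]sub0r -{1}(subrr U) !metricBl subrr sub0r. Qed.

Lemma metric0l W : g 0 W = 0.
Proof. by rewrite -(subrr (0 : vfield M)) metricBl subrr. Qed.

Lemma metricZl (f : Cinf M) U W : g (f *: U) W = f * g U W.
Proof.
have := metric_linear S W f U 0.
by rewrite addr0 !(Defs.metric_sym S W) metric0l addr0.
Qed.

Lemma metric_paraC U V : g (A U) V = - g U (A V).
Proof. by rewrite -{1}[V](para_involutive S) metric_para. Qed.

Lemma metric_inj U V : (forall W, g U W = g V W) -> U = V.
Proof.
move=> UV; apply: vfieldP => f; apply: CinfP => p; apply/eqP.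
rewrite -subr_eq0; apply/eqP.
apply: (@metric_nondegenerate _ _ _ S p (U - V)) => W.
by rewrite metricBl UV subrr.
Qed.

Lemma metric_shift_torsion T K X Y Z p :
  g (shift_torsion T K X Y) Z p = g (T X Y) Z p + g (K X Y) Z p - g (K Y X) Z p.
Proof. by rewrite /shift_torsion metricBl metricDl. Qed.

Lemma nabla_form_metric_shift D T (bT : bilinear_field T) X Y Z :
  nabla_form (shift_connection D bT) g X Y Z =
  nabla_form D g X Y Z - g (T X Y) Z - g (T X Z) Y.
Proof.
rewrite /nabla_form !shift_connectionE ![g Y _]Defs.metric_sym !metricDl; ring.
Qed.

(** Differentiate [F Y Z = g (A Y) Z] by the product rule. *)
Lemma nabla_form_kahler D X Y Z :
  nabla_form D (kahler_form S) X Y Z =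
  g (nabla_endo D A X Y) Z + nabla_form D g X (A Y) Z.
Proof. by rewrite /nabla_form /nabla_endo /kahler_form metricBl; ring. Qed.

Lemma nabla_form_gen_metric D X Y Z :
  nabla_form D (gen_metric S) X Y Z =
  nabla_form D g X Y Z + nabla_form D (kahler_form S) X Y Z.
Proof. by rewrite /nabla_form /gen_metric vfieldD; ring. Qed.

Lemma nabla_endo_metric_shift D T (bT : bilinear_field T) X Y Z :
  g (nabla_endo (shift_connection D bT) A X Y) Z =
  g (nabla_endo D A X Y) Z + g (T X (A Y)) Z + g (T X Y) (A Z).
Proof.
by rewrite /nabla_endo !shift_connectionE !metricBl !metric_paraC !metricDl; ring.
Qed.

Lemma kahler_formC X Y : kahler_form S X Y = - kahler_form S Y X.
Proof. by rewrite /kahler_form metric_paraC Defs.metric_sym. Qed.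

Lemma nabla_form_metricC D X Y Z :
  nabla_form D g X Y Z = nabla_form D g X Z Y.
Proof.
rewrite /nabla_form [g Y Z]Defs.metric_sym [g Y _]Defs.metric_sym.
by rewrite [g (D X Y) Z]Defs.metric_sym; ring.
Qed.

Lemma nabla_form_kahler_shift D T (bT : bilinear_field T) X Y Z :
  nabla_form (shift_connection D bT) (kahler_form S) X Y Z =
  nabla_form D (kahler_form S) X Y Z + g (T X Y) (A Z) - g (T X Z) (A Y).
Proof.
rewrite !nabla_form_kahler nabla_endo_metric_shift nabla_form_metric_shift; ring.
Qed.

Lemma gen_metricE U V : gen_metric S U V = g U V - g U (A V).
Proof. by rewrite /gen_metric /kahler_form metric_paraC. Qed.

Lemma nabla_form_kahlerC D X Y Z :
  nabla_form D (kahler_form S) X Y Z = - nabla_form D (kahler_form S) X Z Y.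
Proof.
rewrite /nabla_form [kahler_form S Y Z]kahler_formC.
rewrite [kahler_form S Y _]kahler_formC [kahler_form S (D X Y) Z]kahler_formC.
by rewrite -[- kahler_form S Z Y]sub0r -{1}(subrr (0 : Cinf M)) !vfieldB; ring.
Qed.

(** * The two difference tensors *)

(** From an adapted connection with torsion [T] to an NGT connection.  On
    eigenvectors of [A] with eigenvalues [a], [b], [c] the coefficient is
    [(a + b + c - a c + b c) / 6 - 1 / 2]. *)
Definition ngt_difference T X Y : vfield M :=
  cst 6^-1 *: (T (A X) Y + T X (A Y) - A (T X Y) + A (T (A X) Y) - A (T X (A Y)))
  - cst 2^-1 *: T X Y.

(** From an NGT connection with torsion [T] to an adapted connection.  On
    eigenvectors of [A] with eigenvalues [a], [b], [c] the coefficient is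
    [a - a b c - (1 - c) / 2]. *)
Definition para_difference T X Y : vfield M :=
  T (A X) Y + A (T (A X) (A Y)) - cst 2^-1 *: (T X Y + A (T X Y)).

Lemma ngt_difference_bilinear T :
  bilinear_field T -> bilinear_field (ngt_difference T).
Proof.
move=> [Tl Tr]; split=> [Y f X Z|X f Y Z]; apply: vfieldP => h.
  rewrite /ngt_difference !(Tl, para_linear).
  rewrite !(vfieldDE, vfieldNE, vfieldZE); ring.
rewrite /ngt_difference !(Tr, para_linear).
rewrite !(vfieldDE, vfieldNE, vfieldZE); ring.
Qed.

Lemma para_difference_bilinear T :
  bilinear_field T -> bilinear_field (para_difference T).
Proof.
move=> [Tl Tr]; split=> [Y f X Z|X f Y Z]; apply: vfieldP => h.
  rewrite /para_difference !(Tl, para_linear).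
  rewrite !(vfieldDE, vfieldNE, vfieldZE); ring.
rewrite /para_difference !(Tr, para_linear).
rewrite !(vfieldDE, vfieldNE, vfieldZE); ring.
Qed.

Lemma ngt_differenceE T X Y Z p :
  g (ngt_difference T X Y) Z p =
    6^-1 * (g (T (A X) Y) Z p + g (T X (A Y)) Z p + g (T X Y) (A Z) p
            - g (T (A X) Y) (A Z) p + g (T X (A Y)) (A Z) p)
    - 2^-1 * g (T X Y) Z p.
Proof.
rewrite /ngt_difference !(metricDl, metricNl, metricZl) !metric_paraC.
rewrite !(CinfDE, CinfME, CinfNE, Cinf_cstE); ring.
Qed.

Lemma para_differenceE T X Y Z p :
  g (para_difference T X Y) Z p =
    g (T (A X) Y) Z p - g (T (A X) (A Y)) (A Z) p
    - 2^-1 * (g (T X Y) Z p - g (T X Y) (A Z) p).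
Proof.
rewrite /para_difference !(metricDl, metricNl, metricZl) !metric_paraC.
rewrite !(CinfDE, CinfME, CinfNE, Cinf_cstE); ring.
Qed.

(** [g (T X Y) Z] is alternating under both adjacent transpositions, as for a
    totally skew-symmetric torsion. *)
Definition skew_field T : Prop :=
  (forall X Y, T X Y = - T Y X) /\ (forall X Y Z, g (T X Y) Z = - g (T X Z) Y).

(** * From an adapted connection to an NGT connection *)

Section NGTFromPara.
Variables (D : connection M) (T : vfield M -> vfield M -> vfield M).
Hypotheses (bT : bilinear_field T) (skT : skew_field T).
Hypothesis Dg : forall X Y Z, nabla_form D g X Y Z = 0.
Hypothesis DA : forall X Y, nabla_endo D A X Y = 0.

(** Exchanging [X] and [Y] exchanges [a] and [b] and changes the sign of [T],
    so in the coefficient of the new torsion the part of the difference tensor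
    symmetric in [a], [b] is doubled, its constant term [- 1 / 2] cancels the
    original torsion, and [(b c - a c) / 6] drops out. *)
Lemma ngt_torsionE X Y Z p :
  g (shift_torsion T (ngt_difference T) X Y) Z p =
    3^-1 * (g (T (A X) Y) Z p + g (T X (A Y)) Z p + g (T X Y) (A Z) p).
Proof.
have [TC _] := skT.
rewrite metric_shift_torsion !ngt_differenceE.
(* Put the slots in the order X, Y, Z, so that equal terms become identical. *)
rewrite ![T Y _]TC ![T (A Y) _]TC !metricNl !CinfNE; lra.
Qed.

Lemma ngt_skew_torsion X Y Z :
  g (shift_torsion T (ngt_difference T) X Y) Z =
  - g (shift_torsion T (ngt_difference T) X Z) Y.
Proof.
have [_ sk] := skT; apply: CinfP => p; rewrite CinfNE !ngt_torsionE.
rewrite ![g (T _ Z) _]sk ![g (T _ (A Z)) _]sk !CinfNE; lra.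
Qed.

(** Since [D] annihilates [g] and [F], the left-hand side comes from the
    difference tensor alone. *)
Lemma ngt_einstein X Y Z :
  nabla_form (shift_connection D (ngt_difference_bilinear bT)) (gen_metric S) X Y Z =
  - gen_metric S (shift_torsion T (ngt_difference T) X Y) Z.
Proof.
have [_ sk] := skT; apply: CinfP => p.
rewrite nabla_form_gen_metric nabla_form_kahler_shift nabla_form_metric_shift.
rewrite nabla_form_kahler DA !Dg gen_metricE metric0l.
rewrite !(CinfDE, CinfNE, Cinf0E) !ngt_differenceE !ngt_torsionE !para_involutive.
rewrite ![g (T _ Z) _]sk ![g (T _ (A Z)) _]sk !CinfNE; lra.
Qed.

End NGTFromPara.

(** * From an NGT connection to an adapted connection *)

Section ParaFromNGT.
Variables (D : connection M) (T : vfield M -> vfield M -> vfield M).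
Hypotheses (bT : bilinear_field T) (skT : skew_field T).
Hypothesis EM : forall X Y Z,
  nabla_form D (gen_metric S) X Y Z = - gen_metric S (T X Y) Z.

(** The part of the Einstein condition symmetric in [Y], [Z]: there [nabla F]
    and the term [g (T X Y) Z] are skew and cancel. *)
Lemma einstein_nabla_metric X Y Z p :
  nabla_form D g X Y Z p = 2^-1 * (g (T X Y) (A Z) p - g (T X (A Y)) Z p).
Proof.
have [_ sk] := skT.
have := EM X Z Y; have := EM X Y Z; rewrite !nabla_form_gen_metric.
rewrite (nabla_form_kahlerC D X Z Y) (nabla_form_metricC D X Z Y).
rewrite !gen_metricE.
move=> /(congr1 (fun f : Cinf M => f p)) E1 /(congr1 (fun f : Cinf M => f p)).
move: E1; rewrite ![g (T _ Z) _]sk !(CinfDE, CinfNE); lra.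
Qed.

Lemma einstein_nabla_kahler X Y Z p :
  nabla_form D (kahler_form S) X Y Z p =
    2^-1 * (g (T X Y) (A Z) p + g (T X (A Y)) Z p) - g (T X Y) Z p.
Proof.
have := EM X Y Z; rewrite nabla_form_gen_metric gen_metricE.
move=> /(congr1 (fun f : Cinf M => f p)).
rewrite CinfDE einstein_nabla_metric CinfNE CinfDE CinfNE; lra.
Qed.

(** The coefficient [a + b + c - 2 a b c] is the inverse of [(a + b + c) / 3]
    for all signs [a], [b], [c]. *)
Lemma para_torsionE X Y Z p :
  g (shift_torsion T (para_difference T) X Y) Z p =
    g (T (A X) Y) Z p + g (T X (A Y)) Z p + g (T X Y) (A Z) p
    - 2 * g (T (A X) (A Y)) (A Z) p.
Proof.
have [TC _] := skT.
rewrite metric_shift_torsion !para_differenceE.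
(* Put the slots in the order X, Y, Z, so that equal terms become identical. *)
rewrite ![T Y _]TC ![T (A Y) _]TC !metricNl !CinfNE; lra.
Qed.

Lemma para_skew_torsion X Y Z :
  g (shift_torsion T (para_difference T) X Y) Z =
  - g (shift_torsion T (para_difference T) X Z) Y.
Proof.
have [_ sk] := skT; apply: CinfP => p; rewrite CinfNE !para_torsionE.
rewrite ![g (T _ Z) _]sk ![g (T _ (A Z)) _]sk !CinfNE; lra.
Qed.

Local Notation P := (shift_connection D (para_difference_bilinear bT)).

Lemma para_nabla_metric X Y Z : nabla_form P g X Y Z = 0.
Proof.
have [_ sk] := skT; apply: CinfP => p.
rewrite nabla_form_metric_shift CinfDE CinfDE einstein_nabla_metric.
rewrite 2!CinfNE Cinf0E !para_differenceE.
rewrite ![g (T _ Z) _]sk ![g (T _ (A Z)) _]sk !CinfNE; lra.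
Qed.

Lemma para_nabla_kahler X Y Z : nabla_form P (kahler_form S) X Y Z = 0.
Proof.
have [_ sk] := skT; apply: CinfP => p.
rewrite nabla_form_kahler_shift CinfDE CinfDE einstein_nabla_kahler.
rewrite CinfNE Cinf0E !para_differenceE !para_involutive.
rewrite ![g (T _ Z) _]sk ![g (T _ (A Z)) _]sk !CinfNE; lra.
Qed.

Lemma para_nabla_endo X Y : nabla_endo P A X Y = 0.
Proof.
apply: metric_inj => Z; have := nabla_form_kahler P X Y Z.
by rewrite para_nabla_kahler para_nabla_metric addr0 metric0l => <-.
Qed.

End ParaFromNGT.
End ParaHermitian.

Theorem mainTheorem7 (R : realType) (m : nat) (M : manifold R m)
    (S : almost_para_hermitian M) :
  (exists D : connection M,
     skew_torsion S D /\ einstein_metricity D (gen_metric S)) <->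
  (exists D' : connection M,
     (forall X Y Z : vfield M, nabla_form D' (metric S) X Y Z = 0%R) /\
     (forall X Y : vfield M, nabla_endo D' (para S) X Y = 0%R) /\
     skew_torsion S D').
Proof.
split=> [[D [skD EM]]|[D [Dg [DA skD]]]].
all: have bT := torsion_bilinear D.
all: have skT : skew_field S (torsion D) by split; [exact: torsionC|exact: skD].
- exists (shift_connection D (para_difference_bilinear S bT)); split.
    by move=> X Y Z; exact: para_nabla_metric.
  split=> [X Y|X Y Z]; first exact: para_nabla_endo.
  by rewrite !torsion_shift; exact: para_skew_torsion.
- exists (shift_connection D (ngt_difference_bilinear S bT)).
  split=> X Y Z; rewrite !torsion_shift; first exact: ngt_skew_torsion.
  exact: ngt_einstein.
Qed.
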